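(* Let $(G,Z,\delta)$ be a nontrivial setup. If $G$ is finite, then $|\mathrm{Mul}\,\delta/\mathrm{Rad}\,\delta|$ is even and $|G|$ is even. Moreover, if $\mathrm{Mul}\,\delta/\mathrm{Rad}\,\delta$ is an elementary abelian $2$-group then $G/\mathrm{Rad}\,f$ is an elementary abelian $2$-group, too.
   Context: Conventions: $x^y=y^{-1}xy$, $[x,y]=x^{-1}y^{-1}xy$; $G'$ is the derived subgroup, $Z(G)$ the center. A (new) setup $(G,Z,\delta)$ consists of a group $G$, a subgroup $Z\le Z(G)$ and a mapping $\delta:G/Z\times G/Z\to Z$ (written $\delta(x,y)$ for $\delta(xZ,yZ)$, and also regarded as a mapping $G\times G\to Z$) such that: $\delta(x,x)=1$ for every $x\in G$; $\delta(x,y)=\delta(y,x)^{-1}$ for every $x,y\in G$; $\delta(xy,z)=\delta(x,z)\delta(y,z)$ whenever $x,y,z\in G$ and $\{x,y,z\}\cap G'\neq\emptyset$; $z^{yx}\delta([z,y],x)=z^{xy}\delta([z,x],y)$ for every $x,y,z\in G$. $\mathrm{Rad}_1\delta=\{t\in G: \delta(tx,y)=\delta(xt,y)=\delta(x,ty)=\delta(x,yt)=\delta(x,y)\text{ for all }x,y\in G\}$, and $\mathrm{Rad}\,\delta$ is the largest normal subgroup of $G$ contained in $\mathrm{Rad}_1\delta$. $\mathrm{Mul}\,\delta$ is the set (a subgroup containing $\mathrm{Rad}\,\delta$) of all $t\in G$ such that for all $x,y\in G$: $\delta(tx,y)=\delta(t,y)\delta(x,y)=\delta(xt,y)$, $\delta(x,ty)=\delta(x,t)\delta(x,y)=\delta(x,yt)$,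 $\delta(xy,t)=\delta(x,t)\delta(y,t)$, $\delta(t,xy)=\delta(t,x)\delta(t,y)$. Mappings $f,g:G^3\to Z$ are defined by $f(x,y,z)=\delta([x,y],z)$ and $g(x,y,z)=f(x,y,z)f(y,z,x)f(z,x,y)$. They are homomorphisms in each argument, and $\mathrm{Rad}\,f=\{t\in G:f(t,x,y)=f(x,t,y)=f(x,y,t)=1\text{ for all }x,y\in G\}$. A setup is nontrivial if $g$ is not identically $1$. *)

(* Defs.v *)
From HB Require Import structures.
From mathcomp Require Import all_boot.
From mathcomp Require Import boolp classical_sets functions cardinality.

Set Implicit Arguments.
Unset Strict Implicit.
Unset Printing Implicit Defensive.

Local Open Scope classical_set_scope.
Local Open Scope card_scope.
Local Open Scope group_scope.

Section Subgroups.
Variable G : groupType.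
Implicit Types (H K N : set G) (x y t : G).

Definition is_subgroup H : Prop := group_closed (mem H).

Definition is_normal_subgroup N : Prop :=
  is_subgroup N /\ forall x t, N t -> N (t ^ x).

Definition center : set G := [set z | forall x, commute z x].

Definition derived : set G :=
  smallest is_subgroup [set [~ x, y] | x in setT & y in setT].

Lemma is_subgroupP H :
  is_subgroup H <-> [/\ H 1, forall x y, H x -> H y -> H (x * y)
                    & forall x, H x -> H x^-1].
Proof.
split=> [sH|[H1 HM HV]].
  have [H1 _] := sH; split; first by move: H1; rewrite inE.
    move=> x y Hx Hy; have := group_closedM sH.
    by move=> /(_ x y); rewrite !inE; apply.
  by move=> x Hx; have /(_ x) := group_closedV sH; rewrite !inE; apply.
split=> [|x y]; rewrite ?inE //= => Hx Hy.
by apply: HM => //; apply: HV.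
Qed.

Lemma derived_subgroup : is_subgroup derived.
Proof.
apply/is_subgroupP; split=> [|x y dx dy|x dx] H [sH cH];
  have [H1 HM HV] := (is_subgroupP H).1 sH => //.
  by apply: HM; [apply: dx | apply: dy].
by apply: HV; apply: dx.
Qed.

Lemma derivedR x y : derived [~ x, y].
Proof. by move=> H [_]; apply; exists x => //; exists y. Qed.

End Subgroups.

Arguments center : clear implicits.
Arguments derived : clear implicits.

(* The data of a quotient group K / H: a subgroup K of G and a subgroup H of  *)
(* K that is normalized by K.                                                 *)
Record section_of (G : groupType) := Section {
  sec_top : set G;
  sec_bot : set G;
  sec_top_subgroup : is_subgroup sec_top;
  sec_bot_subgroup : is_subgroup sec_bot;
  sec_bot_sub : sec_bot `<=` sec_top;
  sec_bot_norm : forall x t, sec_top x -> sec_bot t -> sec_bot (t ^ x)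
}.

Definition cosets (G : groupType) (K H : set G) : set (set G) :=
  [set [set x * h | h in H] | x in K].

Definition quot (G : groupType) (s : section_of G) : Type :=
  {A : set G | A \in cosets (sec_top s) (sec_bot s)}.

(* K / H is a group for the elementwise product of cosets. *)
Section Quotient.
Variables (G : groupType) (s : section_of G).
Local Notation K := (sec_top s).
Local Notation H := (sec_bot s).
Implicit Types (x y : G) (A B C : quot s).

HB.instance Definition _ := Choice.copy (quot s)
  {A : set G | A \in cosets (sec_top s) (sec_bot s)}.

Definition coset_set x : set G := [set x * h | h in H].

Definition set_mul (A B : set G) : set G := [set x * y | x in A & y in B].
Definition set_inv (A : set G) : set G := [set x^-1 | x in A].

Let K1 : K 1. Proof. by case: ((is_subgroupP K).1 (sec_top_subgroup s)). Qed.
Let KM x y : K x -> K y -> K (x * y).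
Proof.
by case: ((is_subgroupP K).1 (sec_top_subgroup s)) => _ KM _; apply: KM.
Qed.
Let KV x : K x -> K x^-1.
Proof.
by case: ((is_subgroupP K).1 (sec_top_subgroup s)) => _ _ KV; apply: KV.
Qed.
Let H1 : H 1. Proof. by case: ((is_subgroupP H).1 (sec_bot_subgroup s)). Qed.
Let HM x y : H x -> H y -> H (x * y).
Proof.
by case: ((is_subgroupP H).1 (sec_bot_subgroup s)) => _ HM _; apply: HM.
Qed.
Let HV x : H x -> H x^-1.
Proof.
by case: ((is_subgroupP H).1 (sec_bot_subgroup s)) => _ _ HV; apply: HV.
Qed.

Lemma set_mul_coset x y : K y ->
  set_mul (coset_set x) (coset_set y) = coset_set (x * y).
Proof.
move=> Ky; apply/seteqP; split=> [_ [_ [h Hh <-]] [_ [k Hk <-]] <-|_ [h Hh <-]].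
  exists (h ^ y * k); first by apply: HM => //; apply: sec_bot_norm.
  by rewrite mulgA -[x * y * _]mulgA -conjgC !mulgA.
exists x; first by exists 1 => //; rewrite mulg1.
by exists (y * h); [exists h | rewrite mulgA].
Qed.

Lemma set_inv_coset x : K x -> set_inv (coset_set x) = coset_set x^-1.
Proof.
move=> Kx; apply/seteqP; split=> [_ [_ [h Hh <-]] <-|_ [h Hh <-]].
  exists ((h^-1) ^ (x^-1)); first by apply: sec_bot_norm; [apply: KV|apply: HV].
  by rewrite invgM -conjgC.
exists (x * (h^-1) ^ x); last first.
  by rewrite -conjgC invgM invgK.
by exists ((h^-1) ^ x) => //; apply: sec_bot_norm => //; apply: HV.
Qed.

Lemma coset_in x : K x -> coset_set x \in cosets K H.
Proof. by move=> Kx; rewrite inE; exists x. Qed.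

Definition to_quot x (Kx : K x) : quot s := exist _ (coset_set x) (coset_in Kx).

Lemma to_quotP A : exists x (Kx : K x), A = to_quot Kx.
Proof.
case: A => A cA; have := cA; rewrite inE => -[x Kx eA].
by exists x, Kx; apply: val_inj; rewrite /= -eA.
Qed.

Lemma quot_mul_subproof A B : set_mul (val A) (val B) \in cosets K H.
Proof.
have [x [Kx ->]] := to_quotP A; have [y [Ky ->]] := to_quotP B.
by rewrite /= set_mul_coset //; apply/coset_in/KM.
Qed.

Lemma quot_inv_subproof A : set_inv (val A) \in cosets K H.
Proof.
have [x [Kx ->]] := to_quotP A.
by rewrite /= set_inv_coset //; apply/coset_in/KV.
Qed.

Definition quot_mul A B : quot s :=
  @exist (set G) (fun X : set G => X \in cosets K H) _ (quot_mul_subproof A B).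
Definition quot_inv A : quot s :=
  @exist (set G) (fun X : set G => X \in cosets K H) _ (quot_inv_subproof A).
Definition quot_one : quot s := to_quot K1.

Fact quot_mulE x y (Kx : K x) (Ky : K y) :
  quot_mul (to_quot Kx) (to_quot Ky) = to_quot (KM Kx Ky).
Proof. by apply: val_inj; rewrite /= set_mul_coset. Qed.

Fact quot_invE x (Kx : K x) : quot_inv (to_quot Kx) = to_quot (KV Kx).
Proof. by apply: val_inj; rewrite /= set_inv_coset. Qed.

Fact quot_mulA : associative quot_mul.
Proof.
move=> A B C; have [x [Kx ->]] := to_quotP A.
have [y [Ky ->]] := to_quotP B; have [z [Kz ->]] := to_quotP C.
by rewrite !quot_mulE; apply: val_inj; rewrite /= mulgA.
Qed.

Fact quot_mul1 : left_id quot_one quot_mul.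
Proof.
move=> A; have [x [Kx ->]] := to_quotP A.
by rewrite quot_mulE; apply: val_inj; rewrite /= mul1g.
Qed.

Fact quot_mulr1 : right_id quot_one quot_mul.
Proof.
move=> A; have [x [Kx ->]] := to_quotP A.
by rewrite quot_mulE; apply: val_inj; rewrite /= mulg1.
Qed.

Fact quot_mulV : left_inverse quot_one quot_inv quot_mul.
Proof.
move=> A; have [x [Kx ->]] := to_quotP A.
by rewrite quot_invE quot_mulE; apply: val_inj; rewrite /= mulVg.
Qed.

Fact quot_mulrV : right_inverse quot_one quot_inv quot_mul.
Proof.
move=> A; have [x [Kx ->]] := to_quotP A.
by rewrite quot_invE quot_mulE; apply: val_inj; rewrite /= mulgV.
Qed.

HB.instance Definition _ := isGroup.Build (quot s)
  quot_mulA quot_mul1 quot_mulr1 quot_mulV quot_mulrV.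

End Quotient.

Definition elementary_abelian (p : nat) (G : groupType) : Prop :=
  (forall x y : G, commute x y) /\ (forall x : G, x ^+ p = 1).

(* Includes the finiteness of T. *)
Definition even_order (T : Type) : Prop :=
  exists2 n : nat, [set: T] #= `I_n & ~~ odd n.

(* A mapping G/Z x G/Z -> Z is encoded by the mapping delta : G -> G -> G it  *)
(* induces, which takes values in Z and is constant on cosets of Z in each    *)
(* argument.                                                                  *)
Record is_setup (G : groupType) (Z : set G) (delta : G -> G -> G) : Prop := {
  setup_Z_subgroup : is_subgroup Z;
  setup_Z_central : Z `<=` center G;
  setup_val : forall x y, Z (delta x y);
  setup_cosetl : forall x y z, Z z -> delta (x * z) y = delta x y;
  setup_cosetr : forall x y z, Z z -> delta x (y * z) = delta x y;
  setup_xx : forall x, delta x x = 1;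
  setup_skew : forall x y, delta x y = (delta y x)^-1;
  setup_mul : forall x y z,
    [\/ derived G x, derived G y | derived G z] ->
    delta (x * y) z = delta x z * delta y z;
  setup_conj : forall x y z,
    z ^ (y * x) * delta [~ z, y] x = z ^ (x * y) * delta [~ z, x] y
}.

Section SetupNotions.
Variables (G : groupType) (delta : G -> G -> G).

Definition Rad1 : set G := [set t | forall x y,
  [/\ delta (t * x) y = delta x y, delta (x * t) y = delta x y,
      delta x (t * y) = delta x y & delta x (y * t) = delta x y]].

(* The largest normal subgroup contained in Rad1; see Rad_largest. *)
Definition Rad : set G :=
  \bigcup_(N in [set N | is_normal_subgroup N /\ N `<=` Rad1]) N.

Definition Mul : set G := [set t | forall x y,
  [/\ delta (t * x) y = delta t y * delta x y /\
        delta (x * t) y = delta t y * delta x y,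
      delta x (t * y) = delta x t * delta x y /\
        delta x (y * t) = delta x t * delta x y,
      delta (x * y) t = delta x t * delta y t
    & delta t (x * y) = delta t x * delta t y]].

Definition setup_f (x y z : G) : G := delta [~ x, y] z.

Definition setup_g (x y z : G) : G :=
  setup_f x y z * setup_f y z x * setup_f z x y.

Definition nontrivial_setup : Prop := exists x y z, setup_g x y z <> 1.

Definition Radf : set G := [set t | forall x y,
  [/\ setup_f t x y = 1, setup_f x t y = 1 & setup_f x y t = 1]].

Lemma Rad1_subgroup : is_subgroup Rad1.
Proof.
apply/is_subgroupP; split=> [x y|s t Rs Rt x y|t Rt x y].
- by rewrite !(mul1g, mulg1).
- have [a b c d] : [/\ delta (s * (t * x)) y = delta x y,
      delta (x * s * t) y = delta x y, delta x (s * (t * y)) = delta x y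
    & delta x (y * s * t) = delta x y].
    by case: (Rs (t * x) y) (Rs x y) (Rs x (t * y)) (Rt x y) (Rt (x * s) y)
      (Rt x (y * s)) => [-> _ _ _] [_ -> _ ->] [_ _ -> _] [-> _ -> _]
      [_ -> _ _] [_ _ _ ->].
  by rewrite !mulgA in a b c d *; split.
- case: (Rt (t^-1 * x) y) (Rt (x * t^-1) y) (Rt x (t^-1 * y))
    (Rt x (y * t^-1)) => [a _ _ _] [_ b _ _] [_ _ c _] [_ _ _ d].
  by rewrite mulVKg in a; rewrite mulgVK in b; rewrite mulVKg in c;
    rewrite mulgVK in d; split.
Qed.

Lemma Rad_largest :
  [/\ is_normal_subgroup Rad, Rad `<=` Rad1
    & forall N, is_normal_subgroup N -> N `<=` Rad1 -> N `<=` Rad].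
Proof.
have [_ R1M _] := (is_subgroupP Rad1).1 Rad1_subgroup.
have max N : is_normal_subgroup N -> N `<=` Rad1 -> N `<=` Rad.
  by move=> nN NR t Nt; exists N.
split=> //; last by move=> t [N [_ NR] Nt]; apply: NR.
split; last first.
  by move=> x t [N [[sN nN] NR] Nt]; exists N => //; apply: nN.
apply/is_subgroupP; split=> [|u v [M [nM MR] Mu] [N [nN NR] Nv]|t [N [nN NR] Nt]].
- exists [set 1] => //; split; last first.
    by move=> _ -> x y; rewrite !(mul1g, mulg1).
  split; last by move=> x _ ->; rewrite conj1g.
  by apply/is_subgroupP; split=> //= [x y -> ->|x ->]; rewrite ?mulg1 ?invg1.
- have [/is_subgroupP[M1 MM MV] Mn] := nM.
  have [/is_subgroupP[N1 NM NV] Nn] := nN.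
  exists [set a * b | a in M & b in N]; last by exists u => //; exists v.
  split; last by move=> _ [a Ma] [b Nb] <-; apply: R1M; [apply: MR|apply: NR].
  split; last first.
    move=> x _ [a Ma] [b Nb] <-; exists (a ^ x); first exact: Mn.
    by exists (b ^ x); [exact: Nn | rewrite conjMg].
  apply/is_subgroupP; split.
  + by exists 1 => //; exists 1 => //; rewrite mulg1.
  + move=> _ _ [a Ma] [b Nb] <- [c Mc] [d Nd] <-.
    exists (a * c); first exact: MM.
    exists (b ^ c * d); first by apply: NM => //; apply: Nn.
    by rewrite mulgA -[a * c * _]mulgA -conjgC !mulgA.
  + move=> _ [a Ma] [b Nb] <-; exists a^-1; first exact: MV.
    exists ((b^-1) ^ (a^-1)); first by apply/Nn/NV.
    by rewrite invgM -conjgC.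
- exists N => //; have [/is_subgroupP[_ _ NV] _] := nN; exact: NV.
Qed.

End SetupNotions.

Section SetupTheory.
Variables (G : groupType) (Z : set G) (delta : G -> G -> G).
Hypothesis hS : is_setup Z delta.
Implicit Types x y z w t : G.
Local Notation f := (setup_f delta).

Lemma setup_Zgroup :
  [/\ Z 1, forall x y, Z x -> Z y -> Z (x * y) & forall x, Z x -> Z x^-1].
Proof. exact/is_subgroupP/(setup_Z_subgroup hS). Qed.

Lemma setup_dC x y z : delta x y * z = z * delta x y.
Proof. exact: (setup_Z_central hS (setup_val hS x y)). Qed.

Lemma setup_mull x y z : derived G x \/ derived G y ->
  delta (x * y) z = delta x z * delta y z.
Proof. by move=> d; apply: (setup_mul hS); case: d; [constructor 1|constructor 2]. Qed.

Lemma setup_mulr x y z : derived G x ->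
  delta x (y * z) = delta x y * delta x z.
Proof.
move=> dx; rewrite (setup_skew hS) (setup_mul hS); last by constructor 3.
by rewrite -setup_dC invgM -!(setup_skew hS) setup_dC setup_dC.
Qed.

Lemma setup_1l y : delta 1 y = 1.
Proof.
have [d1 _ _] := (is_subgroupP _).1 (derived_subgroup G).
apply: (@mulgI _ (delta 1 y)).
by rewrite -setup_mull ?mulg1; [|left].
Qed.

Lemma setup_1r y : delta y 1 = 1.
Proof. by rewrite (setup_skew hS) setup_1l invg1. Qed.

Lemma MulP t :
  (forall x y, [/\ delta (t * x) y = delta t y * delta x y,
                   delta (x * t) y = delta t y * delta x y
                 & delta t (x * y) = delta t x * delta t y]) -> Mul delta t.
Proof.
move=> h x y; have [a b c] := h x y; have [a' b' _] := h y x.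
have iM u v u' v' : (delta u v * delta u' v')^-1 = delta v u * delta v' u'.
  by rewrite setup_dC invgM -!(setup_skew hS).
split=> //; first split.
- by rewrite (setup_skew hS x) a' iM.
- by rewrite (setup_skew hS x) b' iM.
- by rewrite (setup_skew hS) c iM.
Qed.

Lemma Mul_subgroup : is_subgroup (Mul delta).
Proof.
have inv_t t y : Mul delta t -> delta t^-1 y = (delta t y)^-1.
  move=> Mt; apply/esym/mulg1_eq.
  by have [[<- _] _ _ _] := Mt t^-1 y; rewrite mulgV setup_1l.
apply/is_subgroupP; split=> [|s t Ms Mt|t Mt]; apply: MulP => x y.
- by rewrite !(mul1g, mulg1) !setup_1l !mul1g.
- have st u : delta (s * t) u = delta s u * delta t u.
    by have [[]] := Ms t u.
  split.
  + rewrite -mulgA st; have [[-> _] _ _ _] := Ms (t * x) y.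
    by have [[-> _] _ _ _] := Mt x y; rewrite mulgA.
  + rewrite mulgA st; have [[_ ->] _ _ _] := Mt (x * s) y.
    have [[_ ->] _ _ _] := Ms x y.
    by rewrite mulgA; congr (_ * _); rewrite setup_dC.
  + rewrite !st; have [_ _ _ ->] := Ms x y; have [_ _ _ ->] := Mt x y.
    by rewrite !mulgA; congr (_ * _); rewrite -!mulgA; congr (_ * _);
      exact: setup_dC.
- rewrite !inv_t //; split.
  + apply: (@mulgI _ (delta t y)); rewrite mulVKg.
    by have [[<- _] _ _ _] := Mt (t^-1 * x) y; rewrite mulVKg.
  + apply: (@mulgI _ (delta t y)); rewrite mulVKg.
    by have [[_ <-] _ _ _] := Mt (x * t^-1) y; rewrite mulgVK.
  + have [_ _ _ ->] := Mt x y; by rewrite setup_dC invgM.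
Qed.

Lemma Rad_sub_Mul : Rad delta `<=` Mul delta.
Proof.
have [_ RR _] := Rad_largest delta; move=> t /RR Rt; apply: MulP => x y.
have t1 u : delta t u = 1.
  by have [] := Rt 1 u; rewrite mulg1 setup_1l => ->.
by have [-> -> _ _] := Rt x y; rewrite !t1 !mul1g.
Qed.

Lemma Rad_normal : is_normal_subgroup (Rad delta).
Proof. by case: (Rad_largest delta). Qed.

Lemma setup_ZR x y z : Z [~ z, [~ x, y]].
Proof.
have [_ ZM ZV] := setup_Zgroup.
have e := setup_conj hS x y (z ^ (y * x)^-1).
rewrite (commgC x y) [_ ^ (y * x * _)]conjgM !conjgKV in e.
move: e; set a := delta _ _; set b := delta _ _ => e.
have -> : [~ z, [~ x, y]] = a * b^-1.
  apply: (@mulgI _ z); apply: (@mulIg _ b).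
  by rewrite commgEl mulVKg -e -!mulgA mulVg mulg1.
by apply: ZM; [|apply: ZV]; apply: setup_val hS _ _.
Qed.

Lemma setup_f_mul1 x y z w : f (x * y) z w = f x z w * f y z w.
Proof.
rewrite /setup_f.
have -> : [~ x * y, z] = [~ x, z] * [~ [~ x, z], y] * [~ y, z].
  rewrite [[~ [~ x, z], y]]commgEl mulVKg [[~ x * y, z]]commgEl conjMg.
  rewrite [[~ x, z] ^ y]conjgE ![[~ _, z]]commgEl invgM.
  by move: (x ^ z) (y ^ z) => u v; rewrite -!mulgA mulVKg.
rewrite setup_mull; last by right; apply: derivedR.
rewrite (setup_cosetl hS) // -invgR.
by have [_ _ ZV] := setup_Zgroup; apply/ZV/setup_ZR.
Qed.

Lemma setup_f_skew x y z : f y x z = (f x y z)^-1.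
Proof.
apply/esym/mulg1_eq; rewrite /setup_f -setup_mull; last first.
  by left; apply: derivedR.
by rewrite -[[~ y, x]]invgR mulgV setup_1l.
Qed.

Lemma setup_f_mul2 x y z w : f x (y * z) w = f x y w * f x z w.
Proof.
rewrite setup_f_skew setup_f_mul1 invgM -!setup_f_skew.
exact: setup_dC.
Qed.

Lemma setup_f_mul3 x y z w : f x y (z * w) = f x y z * f x y w.
Proof. by rewrite /setup_f setup_mulr //; apply: derivedR. Qed.

Lemma setup_f1 x y : [/\ f 1 x y = 1, f x 1 y = 1 & f x y 1 = 1].
Proof. by rewrite /setup_f comm1g commg1 !setup_1l setup_1r. Qed.

Lemma setup_fV x y z :
  [/\ f x^-1 y z = (f x y z)^-1, f x y^-1 z = (f x y z)^-1
    & f x y z^-1 = (f x y z)^-1].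
Proof.
split; apply/esym/mulg1_eq.
- by rewrite -setup_f_mul1 mulgV; case: (setup_f1 y z).
- by rewrite -setup_f_mul2 mulgV; case: (setup_f1 x z).
- by rewrite -setup_f_mul3 mulgV; case: (setup_f1 x y).
Qed.

Lemma Radf_subgroup : is_subgroup (Radf delta).
Proof.
apply/is_subgroupP; split=> [|s t Rs Rt|t Rt] x y.
- by case: (setup_f1 x y) => -> _ ->; case: (setup_f1 x y).
- rewrite setup_f_mul1 setup_f_mul2 setup_f_mul3.
  by have [-> -> ->] := Rs x y; have [-> -> ->] := Rt x y; rewrite mulg1.
- have [a b c] := Rt x y.
  have [-> _ _] := setup_fV t x y; have [_ -> _] := setup_fV x t y.
  by have [_ _ ->] := setup_fV x y t; rewrite a b c invg1.
Qed.

Lemma Radf_normal : is_normal_subgroup (Radf delta).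
Proof.
split=> [|g t Rt x y]; first exact: Radf_subgroup.
rewrite conjgE !(setup_f_mul1, setup_f_mul2, setup_f_mul3).
have [-> -> ->] := Rt x y; rewrite !mul1g.
have [-> _ _] := setup_fV g x y; have [_ -> _] := setup_fV x g y.
by have [_ _ ->] := setup_fV x y g; rewrite !mulVg.
Qed.

Lemma setT_subgroup : is_subgroup [set: G].
Proof. exact/is_subgroupP. Qed.

Definition Mul_Rad_section : section_of G :=
  Section Mul_subgroup (proj1 Rad_normal) Rad_sub_Mul
    (fun x t _ Rt => proj2 Rad_normal x t Rt).

Definition Radf_section : section_of G :=
  Section setT_subgroup Radf_subgroup (@subsetT _ _)
    (fun x t _ Rt => proj2 Radf_normal x t Rt).

Definition Mul_mod_Rad : groupType := quot Mul_Rad_section.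
Definition G_mod_Radf : groupType := quot Radf_section.

End SetupTheory.

(* Main.v *)
Require Import Defs.
From HB Require Import structures.
From mathcomp Require Import all_boot.
From mathcomp Require Import boolp classical_sets functions cardinality.
From mathcomp Require Import fingroup cyclic.

(**
  The conjugation axiom forces [[x, y], z] = f(x, y, z)^-1 g(x, y, z)
  (setup_commg3), a central element that is multiplicative in x, y and z. In the
  Hall-Witt identity one entry of each commutator is inverted, so its factors
  become the values of f g^-1 at the cyclic permutations of (x, y, z). The three
  values of f multiply to g(x, y, z), while g is invariant under cyclic
  permutations and contributes g(x, y, z)^-3; hence g^2 = 1
  (setup_g_sqr). So a nontrivial setup contains an element of order 2, and a
  finite G has even order by Lagrange.

  The derived subgroup lies in Mul delta, where delta is multiplicative, and
  delta(t, _) = 1 for t in Rad delta. So an exponent n of Mul delta / Rad delta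
  is also an exponent of every value of f (setup_f_exponent), and then of every
  value of g, as these are products of values of f. For odd n, together with
  g^2 = 1, this gives g = 1; hence in a nontrivial setup Mul delta / Rad delta
  has no odd exponent, and its order, if finite, is even by Lagrange.

  For n = 2, trilinearity turns f(x, y, z)^2 = 1 into x^2 being in the radical
  of f. So G / Rad f has exponent 2, which makes it abelian as well.
*)

Set Implicit Arguments.
Unset Strict Implicit.
Unset Printing Implicit Defensive.

Local Open Scope classical_set_scope.
Local Open Scope card_scope.
Local Open Scope group_scope.

Section FiniteCopy.
Variables (T : groupType) (n : nat) (i_of : T -> 'I_n) (of_i : 'I_n -> T).
Hypothesis i_ofK : cancel i_of of_i.

(** The injection into a finite type is a phantom argument of this alias of T,
    so that the finite group structure can be found from the type alone. *)
Definition finite_copy : Type := let _ := i_ofK in T.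

HB.instance Definition _ := Group.copy finite_copy T.
HB.instance Definition _ : isCountable finite_copy := CanIsCountable i_ofK.
HB.instance Definition _ : isFinite finite_copy :=
  @CanIsFinite finite_copy _ _ _ i_ofK.

End FiniteCopy.

(** Lagrange's theorem, transferred from the finite group structure that an
    enumeration puts on T. *)
Lemma expg_card (T : groupType) (n : nat) (x : T) :
  [set: T] #= `I_n -> x ^+ n = 1.
Proof.
move=> /card_set_bijP[f fB].
have fn t : (f t < n)%N by exact: (set_bij_homo fB).
pose i_of t := Ordinal (fn t).
have i_of_bij : bijective i_of.
  rewrite -setTT_bijective; split=> //.
    move=> s t _ _ /(congr1 val)/= /(set_bij_inj fB); apply; exact/mem_set.
  move=> i _; have [t _ ft] := set_bij_surj fB (ltn_ord i).
  by exists t => //; apply: val_inj.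
have [of_i i_ofK of_iK] := i_of_bij.
pose F : finGroupType := finite_copy i_ofK.
have card_F : #|[set: F]%SET| = n.
  by rewrite cardsT (bij_eq_card (f := i_of : F -> 'I_n)) ?card_ord.
by have := expg_cardG (finset.in_setT (x : F)); rewrite card_F.
Qed.

Section GroupIdentities.
Variable T : groupType.
Implicit Types x y z : T.

Lemma Hall_Witt x y z :
  [~ [~ x, y^-1], z] ^ y * [~ [~ y, z^-1], x] ^ z * [~ [~ z, x^-1], y] ^ x = 1.
Proof.
rewrite !commgEl !conjgE !invgM !invgK -!mulgA.
by do !rewrite ?mulKg ?mulVKg ?mulgV ?mulVg ?mulg1.
Qed.

Lemma exponent2_commute :
  (forall x, x ^+ 2 = 1) -> forall x y, commute x y.
Proof.
move=> T2 x y; have invE z : z^-1 = z by apply/mulg1_eq; rewrite -expg2.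
by have := invE (x * y); rewrite invgM !invE => /esym.
Qed.

Lemma expg_odd_involution n x : odd n -> x ^+ n = 1 -> x ^+ 2 = 1 -> x = 1.
Proof.
move=> on xn x2; have := xn.
by rewrite -[n]odd_double_half on -muln2 mulnC expgnDr expgnA x2 expg1n mulg1.
Qed.

(** If the order were odd it would itself be an odd exponent of the group. *)
Lemma even_order_of_odd_exponent : finite_set [set: T] ->
  (forall n, odd n -> ~ forall x, x ^+ n = 1) -> even_order T.
Proof.
move=> /finite_setP[n Tn] evT; exists n => //.
by apply/negP => on; apply: (evT n on) => x; apply: expg_card.
Qed.

End GroupIdentities.

Section QuotientPowers.
Variables (G : groupType) (s : section_of G).
Local Notation K := (sec_top s).
Local Notation H := (sec_bot s).

Lemma coset_set_eq1 x : coset_set s x = coset_set s 1 <-> H x.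
Proof.
have [H1 HM _] := (is_subgroupP H).1 (sec_bot_subgroup s).
have [_ _ HV] := (is_subgroupP H).1 (sec_bot_subgroup s).
split=> [xH | Hx].
  have : coset_set s x x by exists 1; rewrite ?mulg1.
  by rewrite xH => -[h Hh]; rewrite mul1g => <-.
apply/seteqP; split=> _ [h Hh <-].
  by exists (x * h); rewrite ?mul1g //; apply: HM.
by exists (x^-1 * h); rewrite ?mul1g ?mulVKg //; apply: HM => //; apply: HV.
Qed.

Lemma quot_exponentP n :
  (forall A : quot s, A ^+ n = 1) <-> (forall x, K x -> H (x ^+ n)).
Proof.
have val_pow x (Kx : K x) m :
    val (to_quot Kx ^+ m) = coset_set s (x ^+ m) /\ K (x ^+ m).
  have [K1 KM _] := (is_subgroupP K).1 (sec_top_subgroup s).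
  elim: m => [|m [IH Kxm]]; first by [].
  by rewrite !expgS; split; [rewrite /= IH set_mul_coset | apply: KM].
split=> [quotn x Kx | Kn A].
  by apply/coset_set_eq1; rewrite -(val_pow x Kx n).1 quotn.
have [x [Kx ->]] := to_quotP A; apply: val_inj.
by rewrite (val_pow x Kx n).1; apply/coset_set_eq1/Kn.
Qed.

Lemma quot_finite : finite_set [set: G] -> finite_set [set: quot s].
Proof.
pose q x := if pselect (K x) is left Kx then to_quot Kx else 1 : quot s.
move=> /(finite_image q); apply: sub_finite_set => A _.
have [x [Kx ->]] := to_quotP A; exists x => //; rewrite /q.
by case: pselect => // Kx'; apply: val_inj.
Qed.

End QuotientPowers.

Section Setup.
Variables (G : groupType) (Z : set G) (delta : G -> G -> G).
Hypothesis hS : is_setup Z delta.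
Implicit Types x y z t : G.
Local Notation f := (setup_f delta).
Local Notation g := (setup_g delta).

Lemma setup_fC x y z u : commute (f x y z) u.
Proof. exact: setup_dC hS _ _ _. Qed.

Lemma setup_gC x y z u : commute (g x y z) u.
Proof.
by apply/commute_sym; do 2?apply: commuteM; apply/commute_sym/setup_fC.
Qed.

Lemma setup_f_conj u x y z : f (x ^ u) y z = f x y z.
Proof.
rewrite conjgE !(setup_f_mul1 hS); have [-> _ _] := setup_fV hS u y z.
by rewrite setup_fC mulKg.
Qed.

(** The conjugation axiom, applied to the conjugate of z by (y x)^-1, expresses
    z ^ [x, y] by z and two values of f, because x y = y x [x, y] and f does not
    see conjugation. These are the two cyclic factors of g(x, y, z) other than
    f(x, y, z). *)
Lemma setup_commg3 x y z : [~ [~ x, y], z] = (f x y z)^-1 * g x y z.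
Proof.
have e := setup_conj hS x y (z ^ (y * x)^-1).
rewrite (commgC x y) [_ ^ (y * x * _)]conjgM !conjgKV in e.
move: e; rewrite -/(f _ _ _) -/(f _ _ _) !setup_f_conj => e.
have zR : [~ z, [~ x, y]] = f z y x * (f z x y)^-1.
  by rewrite commgEl -[X in _ * X](mulgK (f z x y)) -e -mulgA mulKg.
rewrite -invgR zR invgM invgK -(setup_f_skew hS z) setup_fC.
by rewrite /setup_g -mulgA mulKg.
Qed.

Lemma setup_g_cycle x y z : g y z x = g x y z.
Proof. by rewrite /setup_g -(setup_fC x y z) mulgA. Qed.

Lemma setup_g_sqr x y z : g x y z ^+ 2 = 1.
Proof.
have HW u v w : [~ [~ u, v^-1], w] ^ v = f u v w * (g u v w)^-1.
  have [_ fVv _] := setup_fV hS u v w; have [fVu _ _] := setup_fV hS v w u.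
  have [_ _ fVw] := setup_fV hS w u v.
  have gV : g u v^-1 w = (g u v w)^-1.
    rewrite /setup_g fVv fVu fVw !invgM.
    rewrite -!(setup_f_skew hS) [RHS]setup_fC; congr (_ * _).
    exact: setup_fC.
  rewrite setup_commg3 fVv gV invgK.
  apply/conjg_fixP/commgP/commute_sym.
  by apply: commuteM; [|apply: commuteV]; apply: commute_sym; [exact: setup_fC|exact: setup_gC].
have := Hall_Witt x y z; rewrite !HW.
rewrite (setup_g_cycle y z x) (setup_g_cycle x y z).
set c := (g x y z)^-1 => HWc.
have cC t : commute c t by apply/commute_sym/commuteV/commute_sym/setup_gC.
(* Collects the powers of the central element c on the right. *)
have cM a b k : a * c ^+ k * (b * c) = a * b * c ^+ k.+1.
  rewrite expgSr -!mulgA; congr (_ * _); rewrite !mulgA; congr (_ * _).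
  exact/commute_sym/commuteX/commute_sym/cC.
have c2 : c ^+ 2 = 1.
  by rewrite -[RHS]HWc (cM _ _ 1%N) (cM _ _ 2%N) [c ^+ 3]expgS mulVKg.
by apply: invg_inj; rewrite -expVgn c2 invg1.
Qed.

(** Multiplicativity of delta when one argument is in the derived subgroup is
    an axiom; for a product in the second argument it follows by skewness. *)
Lemma derived_sub_Mul : derived G `<=` Mul delta.
Proof.
move=> t dt; apply: MulP hS _ _ => x y; split.
- by rewrite (setup_mull hS) //; left.
- by rewrite (setup_mull hS); [exact: setup_dC hS _ _ _ | right].
- by rewrite (setup_mulr hS).
Qed.

(** f(x, y, z) = delta([x, y], z) with [x, y] in Mul delta, and its n-th power
    is delta([x, y]^n, z), where [x, y]^n is in Rad delta. *)
Lemma setup_f_exponent n : (forall A : Mul_mod_Rad hS, A ^+ n = 1) ->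
  forall x y z, f x y z ^+ n = 1.
Proof.
move=> /(quot_exponentP (Mul_Rad_section hS) n).1 Mn x y z.
have dX m : delta ([~ x, y] ^+ m) z = f x y z ^+ m.
  elim: m => [|m IH]; first exact: setup_1l hS _.
  rewrite !expgS (setup_mull hS) ?IH //; left; exact: derivedR.
have [_ RR1 _] := Rad_largest delta.
have /RR1 Rt : Rad delta ([~ x, y] ^+ n).
  by apply: (Mn [~ x, y]); apply: derived_sub_Mul; apply: derivedR.
by have [e _ _ _] := Rt 1 z; rewrite -dX -[_ ^+ n]mulg1 e (setup_1l hS).
Qed.

Lemma Mul_mod_Rad_odd_exponent n : nontrivial_setup delta -> odd n ->
  ~ forall A : Mul_mod_Rad hS, A ^+ n = 1.
Proof.
move=> [x [y [z gN1]]] on /setup_f_exponent fn; apply: gN1.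
apply: expg_odd_involution on _ (setup_g_sqr x y z).
by rewrite /setup_g !expgMn ?fn ?mulg1 //; apply/commute_sym/setup_fC.
Qed.

Lemma Radf_sqr : (forall A : Mul_mod_Rad hS, A ^+ 2 = 1) ->
  forall A : G_mod_Radf hS, A ^+ 2 = 1.
Proof.
move=> /setup_f_exponent f2.
apply/(quot_exponentP (Radf_section hS) 2) => t _ x y.
by rewrite !expg2 (setup_f_mul1 hS) (setup_f_mul2 hS) (setup_f_mul3 hS)
  -!expg2 !f2.
Qed.

End Setup.

Theorem lemma6p4 (G : groupType) (Z : set G) (delta : G -> G -> G)
    (hS : is_setup Z delta) (hnt : nontrivial_setup delta) :
  (finite_set [set: G]%classic ->
     even_order (Mul_mod_Rad hS) /\ even_order G) /\
  (elementary_abelian 2 (Mul_mod_Rad hS) ->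
     elementary_abelian 2 (G_mod_Radf hS)).
Proof.
split=> [finG | [_ Mul2]]; last first.
  by split; [apply: exponent2_commute|]; exact: Radf_sqr.
split; apply: even_order_of_odd_exponent.
- exact: (quot_finite (Mul_Rad_section hS)).
- by move=> n; exact: Mul_mod_Rad_odd_exponent.
- by [].
- move=> n on Gn; have [x [y [z]]] := hnt; apply.
  exact: expg_odd_involution on (Gn _) (setup_g_sqr hS x y z).
Qed.
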